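(* Let $\mathcal{G}$ be a Hamiltonian-Hermitian group acting with an equivariant moment map $\mu$ on a Domic-Toledo space $(\mathfrak{X},\Omega,\mathcal{K})$. Let $\mathcal{H}$ be a (possibly infinite-dimensional) Lie group containing $\mathcal{G}$ as a normal subgroup and acting on $\mathfrak{X}$, preserving $\Omega$ and $\mathcal{K}$ and extending the action of $\mathcal{G}$ (not necessarily with a moment map). Assume that $\mu:\mathrm{Lie}(\mathcal{G})\times\mathfrak{X}\to\mathbb{R}$ is equivariant with respect to $\mathcal{H}$, i.e. $\mu(\mathrm{Ad}_hX)(h\cdot x)=\mu(X)(x)$ for all $h\in\mathcal{H}$, $X\in\mathrm{Lie}(\mathcal{G})$, $x\in\mathfrak{X}$ (where $\mathcal H$ acts on $\mathrm{Lie}(\mathcal G)$ by the adjoint representation). Then for all $\widetilde g\in\widetilde{\mathcal{G}}$, $h\in\mathcal{H}$ and $x\in\mathfrak{X}$, $$\nu_x(h\widetilde gh^{-1})=\nu_{h^{-1}x}(\widetilde g),$$ and consequently $\nu(h\widetilde gh^{-1})=\nu(\widetilde g)$ for all $\widetilde g\in\widetilde{\mathcal{G}}$, $h\in\mathcal{H}$. Equivalently, $\nu(\widetilde h\widetilde g\widetilde h^{-1})=\nu(\widetilde g)$ for all $\widetilde g\in\widetilde{\mathcal{G}}$, $\widetilde h\in\widetilde{\mathcal{H}}$.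
   Context: $\widetilde{\mathcal G}$ is the group of homotopy classes, with fixed endpoints, of smooth paths in $\mathcal G$ starting at $\mathrm{Id}$ (similarly $\widetilde{\mathcal H}$). For $\widetilde g=[\{g_t\}]$, $h\widetilde gh^{-1}:=[\{hg_th^{-1}\}]$, and for $\widetilde h=[\{h_t\}]\in\widetilde{\mathcal H}$, $\widetilde h\widetilde g\widetilde h^{-1}:=[\{h_tg_th_t^{-1}\}]\in\widetilde{\mathcal G}$. Equivariant moment map: for an action of a Lie group $\mathcal{G}$ on $(\mathfrak{X},\Omega)$ preserving $\Omega$, a map $\mu:\mathrm{Lie}(\mathcal{G})\times\mathfrak{X}\to\mathbb{R}$, linear in the first variable, with $\iota_{\Xi}\Omega=-d\mu(X)$ for the vector field $\Xi$ on $\mathfrak{X}$ generated by $X$ and with $\mu(\mathrm{Ad}_\phi X)(\phi\cdot x)=\mu(X)(x)$ for all $\phi\in\mathcal{G}$. Domic-Toledo space: a triple $(\mathfrak{X},\Omega,\mathcal{K})$ where $(\mathfrak{X},\Omega)$ is a (possibly infinite-dimensional) connected symplectic manifold with $\pi_1(\mathfrak{X})=\pi_2(\mathfrak{X})=0$, and $\mathcal{K}$ is a system of paths $[x,y]$ from $x$ to $y$, one for every $x,y\in\mathfrak{X}$, such that for a constant $C_{\mathfrak X}$ one has $|\int_{\Delta(x,y,z)}\Omega|<C_{\mathfrak X}$ for all $x,y,z$, where $\Delta(x,y,z)$ is any disk with boundary $[x,y]\cup[y,z]\cup[z,x]$. A group preserves $\mathcal K$ if $g\cdot[x,y]=[g\cdot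 x,g\cdot y]$ for all its elements $g$ and all $x,y$. Hamiltonian-Hermitian group: a (possibly infinite-dimensional) Lie group $\mathcal{G}$ acting on a Domic-Toledo space, preserving $\Omega$ and $\mathcal{K}$, with an equivariant moment map $\mu$. For $x\in\mathfrak X$ and $\widetilde g=[\{g_t\}]\in\widetilde{\mathcal G}$ with $g_1=g$ and $X_t=\dot g_tg_t^{-1}$, the quasimorphism $\nu_x:\widetilde{\mathcal G}\to\mathbb R$ is $\nu_x(\widetilde g)=\int_D\Omega-\int_0^1\mu(X_t)(g_t\cdot x)\,dt$, where $D$ is any disk with boundary $\{g_t\cdot x\}\#[g\cdot x,x]$. Its homogenization $\nu(\widetilde g)=\lim_{k\to\infty}\frac1k\nu_x(\widetilde g^{\,k})$ is independent of $x$. *)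

(* Defs.v *)
From HB Require Import structures.
From mathcomp Require Import all_boot all_order all_algebra.
From mathcomp Require Import all_classical all_reals all_analysis.

Set Implicit Arguments.
Unset Strict Implicit.
Unset Printing Implicit Defensive.

Import Order.TTheory GRing.Theory Num.Theory.
Import numFieldNormedType.Exports.

Local Open Scope classical_set_scope.
Local Open Scope ring_scope.

(* Infinite-dimensional manifolds are modelled on Hausdorff locally convex
   topological vector spaces, with the Michal-Bastiani notion of C^k map (the
   one of Milnor and Hamilton): all directional derivatives exist and
   df : U x E -> F is C^(k-1), where C^0 means continuous. *)

Section Calculus.
Context {R : realType}.

Definition has_dderiv (E F : tvsType R) (f : E -> F) (x v : E) (w : F) : Prop :=
  h^-1 *: (f (x + h *: v) - f x) @[h --> (0 : R)^'] --> w.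

Definition dderiv (E F : tvsType R) (f : E -> F) (x v : E) : F :=
  xget 0 [set w | has_dderiv f x v w].

Fixpoint Ck (k : nat) (E F : tvsType R) (U : set E) (f : E -> F) : Prop :=
  {within U, continuous f} /\
  match k with
  | 0 => True
  | k'.+1 => exists df : E * E -> F,
      (forall x v, U x -> has_dderiv f x v (df (x, v))) /\
      Ck k' (U `*` [set: E]) df
  end.

Definition smooth_on (E F : tvsType R) (U : set E) (f : E -> F) : Prop :=
  forall k, Ck k U f.

End Calculus.

Record chart (M E : Type) := Chart {
  cdom : set M;
  cmap : M -> E;
  cinv : E -> M }.

Definition cimg (M E : Type) (c : chart M E) : set E := cmap c @` cdom c.

(* The raw data of an atlas, with a preferred chart around each point. Keeping
   the axioms (is_manifold) apart lets one form products and vector spaces as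
   charted spaces without proof obligations. *)
Record chartedSpace (R : realType) := ChartedSpace {
  carrier :> topologicalType;
  model : tvsType R;
  atlas : set (chart carrier model);
  chart_at : carrier -> chart carrier model }.

Arguments atlas {R} _ _.
Arguments chart_at {R} _ _.

Section Manifolds.
Context {R : realType}.

Definition is_chart (M : topologicalType) (E : tvsType R) (c : chart M E) :
    Prop :=
  [/\ open (cdom c), open (cimg c),
      (forall p, cdom c p -> cinv c (cmap c p) = p),
      {within cdom c, continuous (cmap c)} &
      {within cimg c, continuous (cinv c)}].

Definition is_manifold (M : chartedSpace R) : Prop :=
  [/\ hausdorff_space M /\ hausdorff_space (model M),
      (forall c, atlas M c -> is_chart c),
      (forall p, atlas M (chart_at M p) /\ cdom (chart_at M p) p) &
      (forall c d, atlas M c -> atlas M d ->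
         smooth_on (cmap c @` (cdom c `&` cdom d)) (cmap d \o cinv c))].

Definition vect_chart (E : tvsType R) : chart E E := Chart [set: E] id id.

Definition vect_space (E : tvsType R) : chartedSpace R :=
  @ChartedSpace R E E [set vect_chart E] (fun=> vect_chart E).

Definition line : chartedSpace R := vect_space R^o.
Definition plane : chartedSpace R := vect_space (R^o * R^o)%type.

Definition prod_chart (M N E F : Type) (c : chart M E) (d : chart N F) :
    chart (M * N) (E * F) :=
  Chart (cdom c `*` cdom d)
        (fun p => (cmap c p.1, cmap d p.2))
        (fun u => (cinv c u.1, cinv d u.2)).

Definition prod_space (M N : chartedSpace R) : chartedSpace R :=
  @ChartedSpace R (M * N)%type (model M * model N)%type
    [set e | exists c d, [/\ atlas M c, atlas N d & e = prod_chart c d]]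
    (fun p => prod_chart (chart_at M p.1) (chart_at N p.2)).

Definition smooth_map (M N : chartedSpace R) (f : M -> N) : Prop :=
  continuous f /\
  forall c d, atlas M c -> atlas N d ->
    smooth_on (cmap c @` (cdom c `&` f @^-1` cdom d))
              (cmap d \o f \o cinv c).

(* T_p M is identified with the model space by means of the preferred chart
   at p. *)
Definition tangent (M : chartedSpace R) (p : M) : tvsType R := model M.

Definition tmap (M N : chartedSpace R) (f : M -> N) (p : M)
    (v : tangent p) : tangent (f p) :=
  dderiv (cmap (chart_at N (f p)) \o f \o cinv (chart_at M p))
         (cmap (chart_at M p) p) v.

Definition smooth_path (M : chartedSpace R) (c : R -> M) : Prop :=
  @smooth_map line M c.

Definition velocity (M : chartedSpace R) (c : R -> M) (t : R) : tangent (c t) :=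
  @tmap line M c t (1 : R).

Definition two_form (M : chartedSpace R) : Type :=
  forall p : M, tangent p -> tangent p -> R.

Definition local_form (M : chartedSpace R) (Omega : two_form M)
    (c : chart M (model M)) (u v w : model M) : R :=
  let T := @tmap (vect_space (model M)) M (cinv c) u in
  Omega (cinv c u) (T v) (T w).

Definition closed_form (M : chartedSpace R) (Omega : two_form M) : Prop :=
  forall c, atlas M c -> forall u, cimg c u -> forall v1 v2 v3 : model M,
    let d v w1 w2 := @dderiv R (model M) R^o
                       (fun u' => local_form Omega c u' w1 w2) u v in
    d v1 v2 v3 + d v2 v3 v1 + d v3 v1 v2 = 0.

(* Nondegeneracy is in the weak sense: v |-> Omega p v is injective. *)
Definition is_symplectic (M : chartedSpace R) (Omega : two_form M) : Prop :=
  [/\ (forall (p : M) (a : R) (u v w : tangent p),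
         Omega p (a *: u + v) w = a * Omega p u w + Omega p v w) /\
      (forall (p : M) (v : tangent p), Omega p v v = 0),
      (forall c, atlas M c ->
         @smooth_on R (model M * model M * model M)%type R^o
           (cimg c `*` [set: model M] `*` [set: model M])
           (fun z => local_form Omega c z.1.1 z.1.2 z.2)),
      closed_form Omega &
      (forall (p : M) (v : tangent p),
         (forall w, Omega p v w = 0) -> v = 0)].

Definition cube (n : nat) : set 'rV[R]_n :=
  [set u | forall i, 0 <= u ord0 i <= 1].

Definition cube_boundary (n : nat) : set 'rV[R]_n :=
  [set u | cube u /\ exists i, u ord0 i = 0 \/ u ord0 i = 1].

Definition trivial_homotopy_group (n : nat) (T : topologicalType) : Prop :=
  forall (x0 : T) (f : 'rV[R]_n -> T),
    {within @cube n, continuous f} ->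
    (forall u, cube_boundary u -> f u = x0) ->
    exists F : R * 'rV[R]_n -> T,
      [/\ {within `[0, 1]%classic `*` @cube n, continuous F},
          (forall u, cube u -> F (0, u) = f u /\ F (1, u) = x0) &
          (forall s u, s \in `[0, 1] -> cube_boundary u -> F (s, u) = x0)].

(* A disk is parametrized by the unit square with its left edge collapsed, so
   that the boundary, run counterclockwise in the coordinates (t, s), is the
   loop a # b # c. *)
Definition fills (M : chartedSpace R) (sigma : R * R -> M) (a b c : R -> M) :
    Prop :=
  @smooth_map plane M sigma /\
  forall t, t \in `[0, 1] ->
    [/\ sigma (t, 0) = a t, sigma (1, t) = b t,
        sigma (t, 1) = c (1 - t) & sigma (0, t) = a 0].

Definition disk_integral (M : chartedSpace R) (Omega : two_form M)
    (sigma : R * R -> M) : R :=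
  \int[lebesgue_measure]_(s in `[0, 1])
    \int[lebesgue_measure]_(t in `[0, 1])
      Omega (sigma (t, s))
        (velocity (fun t' => sigma (t', s)) t)
        (velocity (fun s' => sigma (t, s')) s).

End Manifolds.

Record domicToledo (R : realType) := DomicToledo {
  dt_space :> chartedSpace R;
  dt_form : two_form dt_space;
  dt_path : dt_space -> dt_space -> R -> dt_space;
  dt_manifold : is_manifold dt_space;
  dt_connected : connected [set: dt_space];
  dt_pi1 : @trivial_homotopy_group R 1 dt_space;
  dt_pi2 : @trivial_homotopy_group R 2 dt_space;
  dt_symplectic : is_symplectic dt_form;
  dt_path_smooth : forall x y, smooth_path (dt_path x y);
  dt_path_ends : forall x y, dt_path x y 0 = x /\ dt_path x y 1 = y;
  dt_bounded : exists C : R, forall x y z (sigma : R * R -> dt_space),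
    fills sigma (dt_path x y) (dt_path y z) (dt_path z x) ->
    `|disk_integral dt_form sigma| < C }.

Arguments dt_form {R} _ _ _ _.
Arguments dt_path {R} _ _ _ _.

(* No compatibility here: lieGroup makes the operations smooth. *)
#[short(type="preTopGroupType")]
HB.structure Definition PreTopGroup := {G of Topological G & Group G}.

Record lieGroup (R : realType) := LieGroup {
  lie_carrier :> preTopGroupType;
  lie_model : tvsType R;
  lie_atlas : set (chart lie_carrier lie_model);
  lie_chart_at : lie_carrier -> chart lie_carrier lie_model;
  lie_space := @ChartedSpace R lie_carrier lie_model lie_atlas lie_chart_at;
  lie_manifold : is_manifold lie_space;
  lie_mul_smooth : @smooth_map R (prod_space lie_space lie_space) lie_space
    (fun p => (p.1 * p.2)%g);
  lie_inv_smooth : @smooth_map R lie_space lie_space (fun g => (g^-1)%g) }.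

Section Groups.
Context {R : realType}.

Definition lie_algebra (G : lieGroup R) : tvsType R :=
  @tangent R (lie_space G) (1%g : G).

Definition Ad (G : lieGroup R) (g : G) (V : lie_algebra G) : lie_algebra G :=
  @tmap R (lie_space G) (lie_space G) (fun a : G => (g * a * g^-1)%g) 1%g V.

(* \dot g_t g_t^{-1} *)
Definition right_velocity (G : lieGroup R) (g : R -> G) (t : R) :
    lie_algebra G :=
  @tmap R (lie_space G) (lie_space G) (fun a : G => (a * (g t)^-1)%g) (g t)
    (@velocity R (lie_space G) g t).

(* A Lie group G contained in H as a normal subgroup. Conjugation by elements
   of H restricts to G; it is the action of H on G by smooth automorphisms
   whose derivative at 1 is the adjoint representation of H on Lie(G). *)
Record normalSubgroup (G H : lieGroup R) := NormalSubgroup {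
  nincl : G -> H;
  nincl_inj : injective nincl;
  nincl_mul : forall a b, nincl (a * b)%g = (nincl a * nincl b)%g;
  nincl_smooth : @smooth_map R (lie_space G) (lie_space H) nincl;
  nconj : H -> G -> G;
  nconjE : forall h g, nincl (nconj h g) = (h * nincl g * h^-1)%g;
  nconj_smooth : @smooth_map R (prod_space (lie_space H) (lie_space G))
    (lie_space G) (fun p => nconj p.1 p.2) }.

Definition normal_Ad (G H : lieGroup R) (N : normalSubgroup G H) (h : H)
    (V : lie_algebra G) : lie_algebra G :=
  @tmap R (lie_space G) (lie_space G) (nconj N h) 1%g V.

Definition lie_action (G : lieGroup R) (M : chartedSpace R)
    (act : G -> M -> M) : Prop :=
  [/\ (forall x, act 1%g x = x),
      (forall g h x, act (g * h)%g x = act g (act h x)) &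
      @smooth_map R (prod_space (lie_space G) M) M (fun p => act p.1 p.2)].

Definition preserves_form (G : Type) (M : chartedSpace R)
    (act : G -> M -> M) (Omega : two_form M) : Prop :=
  forall g (x : M) (v w : tangent x),
    Omega (act g x) (tmap (act g) v) (tmap (act g) w) = Omega x v w.

Definition preserves_paths (G : Type) (M : chartedSpace R)
    (act : G -> M -> M) (K : M -> M -> R -> M) : Prop :=
  forall g x y t, t \in `[0, 1] ->
    act g (K x y t) = K (act g x) (act g y) t.

Definition generated_field (G : lieGroup R) (M : chartedSpace R)
    (act : G -> M -> M) (V : lie_algebra G) (x : M) : tangent x :=
  @tmap R (lie_space G) M (fun g => act g x) 1%g V.

Definition equivariant_moment_map (G : lieGroup R) (M : chartedSpace R)
    (Omega : two_form M) (act : G -> M -> M)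
    (mu : lie_algebra G -> M -> R) : Prop :=
  [/\ (forall (a : R) V W x, mu (a *: V + W) x = a * mu V x + mu W x),
      (forall V, @smooth_map R M line (mu V)),
      (forall V (x : M) (w : tangent x),
         Omega x (generated_field act V x) w
         = - (@tmap R M line (mu V) x w : R)) &
      (forall g V x, mu (Ad g V) (act g x) = mu V x)].

Definition hamiltonian_hermitian (X : domicToledo R) (G : lieGroup R)
    (act : G -> X -> X) (mu : lie_algebra G -> X -> R) : Prop :=
  [/\ lie_action act, preserves_form act (dt_form X),
      preserves_paths act (dt_path X) &
      equivariant_moment_map (dt_form X) act mu].

Definition path_homotopic (T : topologicalType) (a b : R -> T) : Prop :=
  exists F : R * R -> T,
    [/\ {within `[0, 1]%classic `*` `[0, 1]%classic, continuous F},
        (forall t, t \in `[0, 1] -> F (t, 0) = a t /\ F (t, 1) = b t) &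
        (forall s, s \in `[0, 1] -> F (0, s) = a 0 /\ F (1, s) = a 1)].

(* [{g_t}]; a path on [0, 1] is given by an extension to the whole line. *)
Definition path_class (G : lieGroup R) (g : R -> G) : set (R -> G) :=
  [set f | @smooth_path R (lie_space G) f /\ path_homotopic g f].

(* The elements of the group of homotopy classes, as sets of paths. *)
Definition tilde (G : lieGroup R) : set (set (R -> G)) :=
  [set A | exists g : R -> G,
     [/\ @smooth_path R (lie_space G) g, g 0 = 1%g & A = path_class g]].

(* Each operation on classes takes the union, over all representatives, of the
   class of the result; on elements of tilde G this is a single class. *)
Definition tone (G : lieGroup R) : set (R -> G) := path_class (fun=> 1%g).

Definition tmul (G : lieGroup R) (A B : set (R -> G)) : set (R -> G) :=
  \bigcup_(f in A) \bigcup_(g in B) path_class (fun t => (f t * g t)%g).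

Definition texp (G : lieGroup R) (A : set (R -> G)) (k : nat) : set (R -> G) :=
  iter k (tmul A) (@tone G).

Definition hconj (G H : lieGroup R) (N : normalSubgroup G H) (h : H)
    (A : set (R -> G)) : set (R -> G) :=
  \bigcup_(g in A) path_class (fun t => nconj N h (g t)).

Definition tconj (G H : lieGroup R) (N : normalSubgroup G H)
    (B : set (R -> H)) (A : set (R -> G)) : set (R -> G) :=
  \bigcup_(h in B) \bigcup_(g in A) path_class (fun t => nconj N (h t) (g t)).

Section Quasimorphism.
Variables (X : domicToledo R) (G : lieGroup R) (act : G -> X -> X).
Variable mu : lie_algebra G -> X -> R.

(* get picks the value given by any representative and any disk. That these all
   agree comes from closedness of Omega, pi_2 = 0 and the moment map
   equation. *)
Definition nu_at (x : X) (A : set (R -> G)) : R :=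
  get [set r | exists (g : R -> G) (sigma : R * R -> X),
    [/\ A g,
        fills sigma (fun t => act (g t) x) (fun=> act (g 1) x)
          (dt_path X (act (g 1) x) x) &
        r = disk_integral (dt_form X) sigma
            - \int[lebesgue_measure]_(t in `[0, 1])
                mu (right_velocity g t) (act (g t) x)]].

(* The limit is the same for every base point x. *)
Definition nu (A : set (R -> G)) : R :=
  get [set r | forall x, (fun k => k%:R^-1 * nu_at x (texp A k)) @ \oo --> r].

End Quasimorphism.

End Groups.

Arguments tilde {R} G _.
Arguments tone {R} G _.

(* Main.v *)
(* Conjugation by [h] carries a path [g_t] and a disk [sigma] computing [nu] at
   [h^-1 x] to the path [h g_t h^-1] and the disk [h sigma] computing it at [x],
   and the value does not change: the velocities of [h sigma] are the images of
   those of [sigma] under the derivative of [h], which preserves [Omega], and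
   the right velocity of [h g_t h^-1] is [Ad_h X_t], so that the equivariance of
   [mu] applies. Both facts are instances of the chain rule for Michal-Bastiani
   smooth maps, whose only analytic ingredient is a mean value theorem in
   locally convex spaces.
   The invariance of [nu] follows because conjugation commutes with products of
   homotopy classes, and a path [h_t] acts through its endpoint [h_1] since
   [h_t g_t h_t^-1] is homotopic to [h_1 g_t h_1^-1]. *)
Require Import Defs.
From mathcomp Require Import all_boot all_order all_algebra.
From mathcomp Require Import all_classical all_reals all_analysis.
From mathcomp Require Import ring lra.

Set Implicit Arguments.
Unset Strict Implicit.
Unset Printing Implicit Defensive.

Import Order.TTheory GRing.Theory Num.Theory.
Import numFieldNormedType.Exports.

Local Open Scope classical_set_scope.
Local Open Scope ring_scope.

Lemma open_setX (S T : topologicalType) (A : set S) (B : set T) :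
  open A -> open B -> open (A `*` B).
Proof.
move=> oA oB; rewrite openE => -[a b] [/= Aa Bb]; exists (A, B) => //=.
by split; exact: open_nbhs_nbhs.
Qed.

(** * The mean value theorem in locally convex spaces *)

Section MeanValue.
Context {R : realType}.
Implicit Types E F G : tvsType R.

(** Local convexity in the form that the mean value argument uses, with the weights as plain real
    numbers. *)
Lemma convex_nbhs E (x : E) (N : set E) : nbhs x N ->
  exists K : set E, [/\ open K, K x, K `<=` N &
    forall (a b : E) (t : R), 0 < t < 1 -> K a -> K b ->
      K (t *: a + (1 - t) *: b)].
Proof.
have [B Bconv [Bopen Bbase]] := @locally_convex R E.
move=> /Bbase [K [BK Kx] KN]; exists K; split => //; first exact: Bopen.
move=> a b t /andP[t0 t1] Ka Kb.
have tl : 0 <= t by exact: ltW.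
have tr : t <= 1 by exact: ltW.
have := Bconv _ (mem_set BK) a b (Itv01 tl tr) (mem_set Ka) (mem_set Kb).
by rewrite inE.
Qed.

(** Mean slopes over adjacent intervals combine convexly, so slopes lying in [K] can be
    concatenated. As [K] is open and contains every derivative, short slopes at each point lie in
    [K], and a supremum argument joins them up to [1]. *)
Lemma mean_value_convex E (K : set E) (phi dphi : R -> E) : open K ->
  (forall (a b : E) (t : R), 0 < t < 1 -> K a -> K b ->
    K (t *: a + (1 - t) *: b)) ->
  (forall s, 0 <= s <= 1 ->
    h^-1 *: (phi (s + h) - phi s) @[h --> (0 : R)^'] --> dphi s) ->
  (forall s, 0 <= s <= 1 -> K (dphi s)) ->
  K (phi 1 - phi 0).
Proof.
move=> oK convK dphiE Kdphi.
pose P a b := K ((b - a)^-1 *: (phi b - phi a)).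
(* The slope over [[a, b]] is the average of the slopes over [[a, c]] and [[c, b]], weighted by
   relative length. *)
have Padd a c b : a < c -> c < b -> P a c -> P c b -> P a b.
  move=> ac cb Pac Pcb; rewrite /P.
  have ab := lt_trans ac cb.
  have -> : (b - a)^-1 *: (phi b - phi a) =
      ((c - a) / (b - a)) *: ((c - a)^-1 *: (phi c - phi a)) +
      (1 - (c - a) / (b - a)) *: ((b - c)^-1 *: (phi b - phi c)).
    have ba0 : b - a != 0 by rewrite subr_eq0 gt_eqF.
    have ca0 : c - a != 0 by rewrite subr_eq0 gt_eqF.
    have bc0 : b - c != 0 by rewrite subr_eq0 gt_eqF.
    have -> : 1 - (c - a) / (b - a) = (b - c) / (b - a) by field.
    have k1 : (c - a) / (b - a) / (c - a) = (b - a)^-1 by field; rewrite ba0.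
    have k2 : (b - c) / (b - a) / (b - c) = (b - a)^-1 by field; rewrite ba0.
    rewrite !scalerA k1 k2 -scalerDr.
    by congr (_ *: _); rewrite [RHS]addrC addrA subrK.
  apply: convK => //; rewrite divr_gt0 ?subr_gt0//=.
  by rewrite ltr_pdivrMr ?subr_gt0// mul1r; lra.
have Ploc s : 0 <= s <= 1 -> exists2 e : R, 0 < e &
    (forall a, s - e < a -> a < s -> P a s) /\
    (forall b, s < b -> b < s + e -> P s b).
  move=> s01; have : nbhs (dphi s) K by apply: open_nbhs_nbhs; split; auto.
  move=> /(dphiE s s01) /=; rewrite /nbhs /= => -[e /= e0 He].
  have {}He h : `|h| < e -> h != 0 -> K (h^-1 *: (phi (s + h) - phi s)).
    by move=> he h0; apply: He => //=; rewrite sub0r normrN.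
  exists e => //; split=> [a h1 h2|b h1 h2]; rewrite /P.
    (* The slope over [[a, s]] is the difference quotient at [s] for the negative increment
       [a - s]. *)
    have -> : (s - a)^-1 *: (phi s - phi a) =
        (a - s)^-1 *: (phi (s + (a - s)) - phi s).
      by rewrite subrKC -[a - s]opprB invrN scaleNr -scalerN opprB.
    by apply: He; [rewrite ltr0_norm; lra | rewrite subr_eq0 lt_eqF].
  rewrite -[in phi b](subrKC s b).
  by apply: He; [rewrite gtr0_norm; lra | rewrite subr_eq0 gt_eqF].
suff : P 0 1 by rewrite /P subr0 invr1 scale1r.
pose S := [set t : R | 0 < t <= 1 /\ P 0 t].
have ubS : ubound S 1 by move=> t [/andP[]].
have [e0 e0_gt0 [_ P0]] := Ploc 0 (introT andP (conj (lexx 0) ler01)).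
rewrite add0r in P0.
(* Halving [e0] stays strictly inside the range where slopes starting at [0] are controlled; the
   minimum keeps the point below [1]. *)
have S0 : S (Num.min (e0 / 2) 1).
  split; first by rewrite lt_min divr_gt0//= ltr01 ge_min lexx orbT.
  apply: P0; first by rewrite lt_min divr_gt0//= ltr01.
  by rewrite gt_min ltr_pdivrMr//; apply/orP; left; lra.
pose c := sup S.
have hS : has_sup S by split; [exists (Num.min (e0 / 2) 1) | exists 1].
have c0 : 0 < c.
  apply: (@lt_le_trans _ _ (Num.min (e0 / 2) 1)).
    by rewrite lt_min divr_gt0//= ltr01.
  by apply: ub_le_sup => //; exists 1.
have c1 : c <= 1 by apply: ge_sup => //; exists (Num.min (e0 / 2) 1).
have [e e_gt0 [Pl Pr]] := Ploc c (introT andP (conj (ltW c0) c1)).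
have [t [/andP[t0 t1] Pt] ct] := sup_adherent e_gt0 hS.
have tc : t <= c by apply: ub_le_sup; [exists 1 | split; rewrite ?t0].
(* The supremum is attained: some [t] in [S] is within [e] of [c], and the slope over [[t, c]] is
   controlled from the left of [c]. *)
have Pc : P 0 c.
  have [<-//|tnc] := eqVneq t c.
  have tltc : t < c by rewrite lt_neqAle tnc.
  by apply: (@Padd _ t) => //; exact: Pl.
move: c1; rewrite le_eqVlt => /orP[/eqP <-//|c1].
(* If [c < 1], the control to the right of [c] puts a larger point into [S], a contradiction. *)
pose b := Num.min (c + e / 2) 1.
have cb : c < b by rewrite lt_min c1 andbT; lra.
have : b <= c.
  apply: ub_le_sup; first by exists 1.
  split; first by rewrite (lt_trans c0 cb)/= ge_min lexx orbT.
  apply: (@Padd _ c) => //; apply: Pr => //.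
  by rewrite gt_min; apply/orP; left; lra.
by rewrite leNgt cb.
Qed.

(* The quotient [h^-1 (f (y + h w_h) - f y)] is a mean of the derivatives
   [df (y + s h w_h, w_h)], hence lies in every convex neighbourhood of
   [df (y, v)] for small [h]. *)
Lemma dderiv_along E F (U : set E) (f : E -> F) (df : E * E -> F) (y v : E)
    (w : R -> E) : open U ->
  (forall x u, U x -> has_dderiv f x u (df (x, u))) ->
  {within U `*` [set: E], continuous df} -> U y ->
  w h @[h --> (0 : R)^'] --> v ->
  h^-1 *: (f (y + h *: w h) - f y) @[h --> (0 : R)^'] --> df (y, v).
Proof.
move=> oU fdf cdf Uy wv.
have oUT : open (U `*` [set: E]) by apply: open_setX => //; exact: openT.
move: cdf; rewrite continuous_open_subspace// => cdf.
have {}cdf : {for (y, v), continuous df} by apply: cdf; rewrite inE.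
move=> N /convex_nbhs[K [oK Kdf KN Kconv]].
have /= := cdf K (open_nbhs_nbhs (conj oK Kdf)).
rewrite /nbhs /= => -[[A B] /= [Ay Bv] ABK].
have AUy : nbhs y (A `&` U) by apply: filterI => //; exact: open_nbhs_nbhs.
(* Joint continuity at [(0, v)] keeps the whole segment from [y] to [y + h *: w h] inside [A] and
   [U] for small [h]. *)
have cont :
    {for ((0 : R^o), v), continuous (fun p : R^o * E => y + p.1 *: p.2)}.
  apply: (@cvg_comp _ _ _ (fun p : R^o * E => (y, p.1 *: p.2))
    (fun p => p.1 + p.2));
    last exact: (@add_continuous E (y, 0 *: v)).
  apply: cvg_pair; first exact: cvg_cst.
  exact: (@scale_continuous R E (0, v)).
have /= := cont (A `&` U); rewrite scale0r addr0 => /(_ AUy).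
rewrite /nbhs /= => -[[C D] /= [[e /= e0 Ce] Dv] CDA].
have wDB : \forall h \near (0 : R)^', (B `&` D) (w h) := wv _ (filterI Bv Dv).
near=> h.
have h0 : h != 0 by near: h; exact: nbhs_dnbhs_neq.
have he : `|h| < e by near: h; exact: dnbhs0_lt.
have [Bw Dw] : (B `&` D) (w h) by near: h; exact: wDB.
have ACw s : 0 <= s <= 1 -> (A `&` U) (y + (s * h) *: w h).
  move=> /andP[s0 s1]; apply: (CDA (s * h, w h)); split => //=.
  apply: Ce => /=; rewrite sub0r normrN normrM ger0_norm//.
  by rewrite (le_lt_trans _ he)// ler_piMl.
apply: KN.
(* The factor [h^-1] cancels the [h] produced by differentiating in [s], so that [phi] has
   derivative [df (y + (s * h) *: w h, w h)]. *)
pose phi (s : R) := h^-1 *: f (y + (s * h) *: w h).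
have -> : h^-1 *: (f (y + h *: w h) - f y) = phi 1 - phi 0.
  by rewrite /phi mul1r mul0r scale0r addr0 scalerBr.
apply: (@mean_value_convex _ K phi
  (fun s => df (y + (s * h) *: w h, w h))) => //.
  move=> s s01; have [_ Us] := ACw s s01.
  (* This allows the change of variable from the increment [k] of [s] to the increment [h * k] along
     the segment. *)
  have hk : h * k @[k --> (0 : R)^'] --> (0 : R)^'.
    move=> W; rewrite /nbhs/= => -[d /= d0 Wd]; exists (d / `|h|) => /=.
      by rewrite divr_gt0// normr_gt0.
    move=> k /=; rewrite sub0r normrN ltr_pdivlMr ?normr_gt0// mulrC => kd k0.
    by apply: Wd => /=; rewrite ?sub0r ?normrN ?normrM// mulf_neq0.
  have := cvg_comp _ _ hk (fdf _ (w h) Us).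
  apply: cvg_trans; apply: near_eq_cvg; near=> k.
  rewrite /phi /= -scalerBr scalerA -invfM (mulrC k) -addrA -scalerDl.
  by rewrite (mulrDl s k h) (mulrC h k).
move=> s s01; have [As _] := ACw s s01.
by apply: (ABK (_, _)).
Unshelve. all: by end_near. Qed.

End MeanValue.

(** * Michal-Bastiani calculus *)

Section Ck.
Context {R : realType}.
Implicit Types E F G : tvsType R.

Lemma has_dderiv_near E F (f g : E -> F) (x v : E) (w : F) :
  (\forall y \near x, f y = g y) -> has_dderiv f x v w -> has_dderiv g x v w.
Proof.
move=> fg; apply: cvg_trans; apply: near_eq_cvg.
have cont : {for (0 : R^o), continuous (fun h : R^o => x + h *: v)}.
  apply: (@cvg_comp _ _ _ (fun h : R^o => (x, h *: v)) (fun p => p.1 + p.2));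
    last exact: (@add_continuous E (x, 0 *: v)).
  apply: cvg_pair; first exact: cvg_cst.
  apply: (@cvg_comp _ _ _ (fun h : R^o => (h, v))
    (fun p : R^o * E => p.1 *: p.2));
    last exact: (@scale_continuous R E (0, v)).
  exact: (cvg_pair (@cvg_id _ (nbhs (0 : R^o))) (cvg_cst v)).
have := cont [set y | f y = g y]; rewrite scale0r addr0 => /(_ fg).
move=> /nbhs_dnbhs; apply: filterS => h ->.
by rewrite (nbhs_singleton fg).
Qed.

(** Limits are unique in a Hausdorff space, so the limit that [xget] picks is [w]. *)
Lemma dderivE E F (f : E -> F) (x v : E) (w : F) :
  hausdorff_space F -> has_dderiv f x v w -> dderiv f x v = w.
Proof.
move=> hF fw; apply: (cvg_unique hF _ fw).
by rewrite /dderiv; case: xgetP => // /(_ w).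
Qed.

Lemma dderiv_near E F (f g : E -> F) (x v : E) :
  (\forall y \near x, f y = g y) -> dderiv f x v = dderiv g x v.
Proof.
move=> fg; rewrite /dderiv; congr xget; apply/seteqP; split=> w /=.
  exact: has_dderiv_near.
by apply: has_dderiv_near; apply: filterS fg.
Qed.

(** Write [f (x + h *: v)] as [f x + h *: w h], where [w h] is the difference quotient of [f]; then
    [dderiv_along] applies to [g] with this moving direction. *)
Lemma has_dderiv_comp E F G (V : set F) (f : E -> F) (g : F -> G)
    (dg : F * F -> G) (x v : E) (w : F) : open V -> V (f x) ->
  (forall y u, V y -> has_dderiv g y u (dg (y, u))) ->
  {within V `*` [set: F], continuous dg} ->
  has_dderiv f x v w -> has_dderiv (g \o f) x v (dg (f x, w)).
Proof.
move=> oV Vfx gdg cdg fw.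
have := dderiv_along oV gdg cdg Vfx fw.
apply: cvg_trans; apply: near_eq_cvg; near=> h.
have h0 : h != 0 by near: h; exact: nbhs_dnbhs_neq.
by rewrite scalerA divff// scale1r subrKC.
Unshelve. all: by end_near. Qed.

Lemma Ck_continuous k E F (U : set E) (f : E -> F) :
  Ck k U f -> {within U, continuous f}.
Proof. by case: k => [|k] []. Qed.

Lemma CkS k E F (U : set E) (f : E -> F) : Ck k.+1 U f -> Ck k U f.
Proof.
elim: k E F U f => [|k IHk] E F U f [cf [df [fdf Cdf]]]; split=> //.
by exists df; split=> //; exact: IHk.
Qed.

Lemma Ck_subset k E F (U V : set E) (f : E -> F) :
  V `<=` U -> Ck k U f -> Ck k V f.
Proof.
elim: k E F U V f => [|k IHk] E F U V f VU [cf Cf].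
  by split=> //; exact: continuous_subspaceW cf.
split; first exact: continuous_subspaceW cf.
have [df [fdf Cdf]] := Cf; exists df; split=> [x v /VU|]; first exact: fdf.
by apply: IHk Cdf => -[x v] [/VU].
Qed.

Lemma Ck_eq k E F (U : set E) (f g : E -> F) : open U ->
  {in U, f =1 g} -> Ck k U f -> Ck k U g.
Proof.
move=> oU fg; case: k => [|k] [cf Cf]; split=> //;
  try exact: subspace_eq_continuous cf.
have [df [fdf Cdf]] := Cf; exists df; split=> // x v Ux.
apply: has_dderiv_near (fdf x v Ux).
by apply: filterS (open_nbhs_nbhs (conj oU Ux)) => y Uy; apply: fg; rewrite inE.
Qed.

Lemma Ck_cst k E F (U : set E) (a : F) : Ck k U (fun=> a).
Proof.
have cst_cts E' (U' : set E') (b : F) : {within U', continuous (fun=> b)}.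
  by apply: continuous_subspaceT => x; exact: cvg_cst.
elim: k E U a => [|k IHk] E U a; split=> //.
exists (fun=> 0); split=> // x v _; rewrite /has_dderiv subrr.
under eq_fun do rewrite scaler0.
exact: cvg_cst.
Qed.

(** The derivative of [L] is [L \o snd], again linear and continuous, so the induction closes. *)
Lemma Ck_linear k E F (U : set E) (L : E -> F) : linear L -> continuous L ->
  Ck k U L.
Proof.
elim: k E U L => [|k IHk] E U L linL cL; split=> //;
  try exact: continuous_subspaceT.
exists (L \o snd); split=> [x v _|].
  have : (fun=> L v) @ (0 : R)^' --> L v by exact: cvg_cst.
  apply: cvg_trans; apply: near_eq_cvg; near=> h.
  have h0 : h != 0 by near: h; exact: nbhs_dnbhs_neq.
  by rewrite (addrC x) linL addrK scalerA mulVf// scale1r.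
apply: IHk; first by move=> a [u1 u2] [v1 v2]; exact: linL.
by move=> p; apply: continuous_comp; [exact: cvg_snd | exact: cL].
Unshelve. all: by end_near. Qed.

Lemma Ck_pair k E F G (U : set E) (f : E -> F) (g : E -> G) :
  Ck k U f -> Ck k U g -> Ck k U (fun x => (f x, g x)).
Proof.
elim: k E F G U f g => [|k IHk] E F G U f g [cf Cf] [cg Cg]; split=> //;
  try by move=> x; exact: cvg_pair (cf x) (cg x).
have [df [fdf Cdf]] := Cf; have [dg [gdg Cdg]] := Cg.
exists (fun p => (df p, dg p)); split; last exact: IHk.
by move=> x v Ux; exact: cvg_pair (fdf x v Ux) (gdg x v Ux).
Qed.

Lemma within_continuous_comp_sub (S T Z : topologicalType) (A : set S)
    (B : set T) (f : S -> T) (g : T -> Z) : f @` A `<=` B ->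
  {within A, continuous f} -> {within B, continuous g} ->
  {within A, continuous (g \o f)}.
Proof.
move=> fAB /subspace_continuousP cf /subspace_continuousP cg.
apply/subspace_continuousP => x Ax.
have Bfx : B (f x) by apply: fAB; exists x.
move=> W /(cg _ Bfx) /= /(cf _ Ax) /=; rewrite /nbhs /= /within /=.
rewrite !near_simpl /=; apply: filterS => y /= + Ay.
by apply => //; apply: fAB; exists y.
Qed.

(** The derivative of [g \o f] is [dg] after [(f \o fst, df)], a composite of one order less. The
    component [f \o fst] is itself a composite, so the induction hypothesis serves twice. *)
Lemma Ck_comp k E F G (U : set E) (V : set F) (f : E -> F) (g : F -> G) :
  open U -> open V -> f @` U `<=` V -> Ck k U f -> Ck k V g ->
  Ck k U (g \o f).
Proof.
elim: k E F G U V f g => [|k IHk] E F G U V f g oU oV fUV Cf Cg.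
  by split=> //; exact: within_continuous_comp_sub fUV Cf.1 Cg.1.
split; first exact: within_continuous_comp_sub fUV Cf.1 Cg.1.
have [_ [df [fdf Cdf]]] := Cf; have [_ [dg [gdg Cdg]]] := Cg.
have oUT : open (U `*` [set: E]) by apply: open_setX => //; exact: openT.
have oVT : open (V `*` [set: F]) by apply: open_setX => //; exact: openT.
exists (dg \o (fun p => (f p.1, df p))); split=> [x v Ux|].
  have Vfx : V (f x) by apply: fUV; exists x.
  exact: has_dderiv_comp (Ck_continuous Cdg) (fdf x v Ux).
apply: (IHk _ _ _ _ _ _ _ oUT oVT) Cdg.
  by move=> _ [[x v] [/= Ux _] <-]; split=> //; apply: fUV; exists x.
apply: Ck_pair => //.
apply: (IHk _ _ _ _ U fst f) => //.
- by move=> _ [[x v] [/= Ux _] <-].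
- by apply: Ck_linear => // p; exact: cvg_fst.
- exact: CkS.
Qed.

(** Since [F] is Hausdorff, every local derivative must equal [dderiv f]; hence the local ones glue
    to a single derivative on [U]. *)
Lemma Ck_local k E F (U : set E) (f : E -> F) : hausdorff_space F -> open U ->
  (forall x, U x -> exists W : set E, [/\ open W, W x & Ck k W f]) ->
  Ck k U f.
Proof.
move=> hF; elim: k E U f => [|k IHk] E U f oU Ul.
  split=> //; rewrite continuous_open_subspace// => x; rewrite inE => Ux.
  have [W [oW Wx [+ _]]] := Ul _ Ux.
  by rewrite continuous_open_subspace//; apply; rewrite inE.
split.
  rewrite continuous_open_subspace// => x; rewrite inE => Ux.
  have [W [oW Wx [+ _]]] := Ul _ Ux.
  by rewrite continuous_open_subspace//; apply; rewrite inE.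
exists (fun p => dderiv f p.1 p.2); split=> [x v Ux|].
  have [W [oW Wx [_ [df [fdf _]]]]] := Ul _ Ux.
  by rewrite /= (dderivE hF (fdf x v Wx)); exact: fdf.
apply: IHk => [|[x v] [/= Ux _]]; first by apply: open_setX => //; exact: openT.
have [W [oW Wx [_ [df [fdf Cdf]]]]] := Ul _ Ux.
have oWT : open (W `*` [set: E]) by apply: open_setX => //; exact: openT.
exists (W `*` [set: E]); split=> //.
apply: Ck_eq Cdf => // -[y u]; rewrite inE => -[/= Wy _].
by rewrite (dderivE hF (fdf y u Wy)).
Qed.

End Ck.

(** * Smooth maps of manifolds *)

Section Manifolds.
Context {R : realType}.
Implicit Types M N P : chartedSpace R.

Lemma chart_image_open (T : topologicalType) (E : tvsType R) (c : chart T E)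
    (O : set T) : is_chart c -> open O -> O `<=` cdom c -> open (cmap c @` O).
Proof.
move=> [_ oimg cK _ cinvc] oO Oc.
have -> : cmap c @` O = cimg c `&` cinv c @^-1` O.
  apply/seteqP; split=> [_ [p Op <-]|u [[p cp <-]]] /=.
    by split; [exact: imageP (Oc _ Op) | rewrite cK//; exact: Oc].
  by rewrite cK// => Op; exists p.
move: cinvc; rewrite continuous_open_subspace// => /(continuous_inP _ oimg).
exact.
Qed.

Lemma smooth_domain_open M N (f : M -> N) (c : chart M (model M))
    (d : chart N (model N)) : is_chart c -> is_chart d ->
  continuous f -> open (cmap c @` (cdom c `&` f @^-1` cdom d)).
Proof.
move=> chc [od _ _ _ _] /continuousP cf; have [oc _ _ _ _] := chc.
by apply: chart_image_open => //; apply: openI => //; exact: cf.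
Qed.

(** A chart domain of [M] may be sent by [f] across several charts of [N]. Near each point the
    composite factors through the preferred chart [e] at [f p], and [Ck_local] assembles the
    pieces. *)
Lemma smooth_map_comp M N P (g : N -> P) (f : M -> N) :
  is_manifold M -> is_manifold N -> is_manifold P ->
  smooth_map g -> smooth_map f -> smooth_map (g \o f).
Proof.
move=> [_ chM _ _] [_ chN atN _] [[_ hP] chP _ _] [cg sg] [cf sf].
have cgf : continuous (g \o f).
  by move=> x; apply: continuous_comp; [exact: cf | exact: cg].
split=> // c d Mc Pd k; have [cc dd] := (chM _ Mc, chP _ Pd).
apply: Ck_local => //; first exact: (smooth_domain_open cc dd cgf).
move=> _ [p [cp dgfp] <-]; have [Ne ep] := atN (f p).
set e := chart_at N (f p) in Ne ep.
have ee := chN _ Ne.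
pose V := cmap e @` (cdom e `&` g @^-1` cdom d).
(* Coordinates of the points that [f] sends into the domain of [e] and [g \o f] into that of [d];
   there the coordinate expressions compose. *)
pose W := cmap c @` (cdom c `&` (f @^-1` (cdom e `&` g @^-1` cdom d))).
have oW : open W.
  apply: (chart_image_open cc _ (@subIsetl _ _ _)).
  have [oc _ _ _ _] := cc; have [oe _ _ _ _] := ee; have [od _ _ _ _] := dd.
  apply: openI => //; move/continuousP: cf; apply; apply: openI => //.
  by move/continuousP: cg; apply.
exists W; split=> //; first by exists p.
have [_ _ cK _ _] := cc; have [_ _ eK _ _] := ee.
have : Ck k W ((cmap d \o g \o cinv e) \o (cmap e \o f \o cinv c)).
  apply: (Ck_comp oW (smooth_domain_open ee dd cg)); last exact: sg.
    by move=> _ [_ [q [cq [eq dq]] <-] <-]; exists (f q); rewrite //= cK.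
  apply: Ck_subset (sf c e Mc Ne k) => _ [q [cq [eq dq]] <-].
  by exists q.
apply: Ck_eq => // u; rewrite inE => -[q [cq [eq dq]] <-] /=.
by rewrite cK// eK.
Qed.

Lemma is_chart_prod (S T : topologicalType) (E F : tvsType R) (c : chart S E)
    (d : chart T F) : is_chart c -> is_chart d -> is_chart (prod_chart c d).
Proof.
have within_prod (S1 S2 T1 T2 : topologicalType) (f : S1 -> T1) (g : S2 -> T2)
    (A : set S1) (B : set S2) : {within A, continuous f} ->
    {within B, continuous g} ->
    {within A `*` B, continuous (fun p => (f p.1, g p.2))}.
  move=> cf cg x; apply: cvg_pair.
    apply: (@within_continuous_comp_sub _ _ _ (A `*` B) A fst f) => //.
      by move=> _ [[a b] [/= Aa _] <-].
    by apply: continuous_subspaceT => p; exact: cvg_fst.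
  apply: (@within_continuous_comp_sub _ _ _ (A `*` B) B snd g) => //.
    by move=> _ [[a b] [/= _ Bb] <-].
  by apply: continuous_subspaceT => p; exact: cvg_snd.
move=> [oc oic cK cc cic] [od oid dK cd cid].
have cimgE : cimg (prod_chart c d) = cimg c `*` cimg d.
  apply/seteqP; split=> [_ [[p q] [/= cp dq] <-]|].
    by split; exists p || exists q.
  by move=> [u v] [/= [p cp <-] [q dq <-]]; exists (p, q).
split; rewrite ?cimgE.
- exact: open_setX.
- exact: open_setX.
- by move=> [p q] [/= cp dq]; rewrite cK// dK.
- exact: within_prod.
- exact: within_prod.
Qed.

(** In the preferred chart [e] at [a], the slice is the coordinate expression of [f] composed with
    [u |-> (cmap e a, u)], a constant paired with the identity. *)
Lemma smooth_map_slicer M N P (f : prod_space M N -> P) (a : M) :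
  is_manifold M -> is_manifold N -> is_manifold P ->
  smooth_map f -> @smooth_map R N P (fun y => f (a, y)).
Proof.
move=> [_ chM atM _] [_ chN _ _] [_ chP _ _] [cf sf].
have cfa : continuous (fun y => f (a, y)).
  move=> y; apply: continuous_comp; last exact: cf.
  exact: cvg_pair (cvg_cst a) cvg_id.
split=> // c d Nc Pd k; have [Me ea] := atM a.
set e := chart_at M a in Me ea.
have [_ _ eK _ _] := chM _ Me; have [_ _ cK _ _] := chN _ Nc.
have Aec : atlas (prod_space M N) (prod_chart e c) by exists e, c.
have ec := is_chart_prod (chM _ Me) (chN _ Nc).
have oU := @smooth_domain_open N P _ c d (chN _ Nc) (chP _ Pd) cfa.
have oV := @smooth_domain_open (prod_space M N) P _ _ d ec (chP _ Pd) cf.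
have : Ck k (cmap c @` (cdom c `&` (fun y => f (a, y)) @^-1` cdom d))
    ((cmap d \o f \o cinv (prod_chart e c)) \o (fun u => (cmap e a, u))).
  apply: (Ck_comp oU oV); last exact: sf.
    by move=> _ [_ [q [/= cq dq] <-] <-]; exists (a, q).
  by apply: Ck_pair; [exact: Ck_cst | apply: Ck_linear => // x; exact: cvg_id].
by apply: Ck_eq => // _ /set_mem[q [/= cq dq] <-]; rewrite /= eK.
Qed.

Lemma smooth_map_slicel M N P (f : prod_space M N -> P) (b : N) :
  is_manifold M -> is_manifold N -> is_manifold P ->
  smooth_map f -> @smooth_map R M P (fun x => f (x, b)).
Proof.
move=> [_ chM _ _] [_ chN atN _] [_ chP _ _] [cf sf].
have cfb : continuous (fun x => f (x, b)).
  move=> x; apply: continuous_comp; last exact: cf.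
  exact: cvg_pair cvg_id (cvg_cst b).
split=> // c d Mc Pd k; have [Ne eb] := atN b.
set e := chart_at N b in Ne eb.
have [_ _ eK _ _] := chN _ Ne; have [_ _ cK _ _] := chM _ Mc.
have Ace : atlas (prod_space M N) (prod_chart c e) by exists c, e.
have ce := is_chart_prod (chM _ Mc) (chN _ Ne).
have oU := @smooth_domain_open M P _ c d (chM _ Mc) (chP _ Pd) cfb.
have oV := @smooth_domain_open (prod_space M N) P _ _ d ce (chP _ Pd) cf.
have : Ck k (cmap c @` (cdom c `&` (fun x => f (x, b)) @^-1` cdom d))
    ((cmap d \o f \o cinv (prod_chart c e)) \o (fun u => (u, cmap e b))).
  apply: (Ck_comp oU oV); last exact: sf.
    by move=> _ [_ [q [/= cq dq] <-] <-]; exists (q, b).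
  by apply: Ck_pair; [apply: Ck_linear => // x; exact: cvg_id | exact: Ck_cst].
by apply: Ck_eq => // _ /set_mem[q [/= cq dq] <-]; rewrite /= eK.
Qed.

Lemma is_chart_vect (E : tvsType R) : is_chart (vect_chart E).
Proof.
have cimgE : cimg (vect_chart E) = [set: E].
  by apply/seteqP; split=> // x _; exists x.
split; rewrite ?cimgE //; try exact: openT;
  by apply: continuous_subspaceT => x; exact: cvg_id.
Qed.

Lemma is_manifold_vect (E : tvsType R) : hausdorff_space E ->
  is_manifold (vect_space E).
Proof.
move=> hE; split=> // [_ ->|_ _ -> -> k]; first exact: is_chart_vect.
by apply: Ck_linear => // x; exact: cvg_id.
Qed.

Lemma is_manifold_line : is_manifold (@line R).
Proof. by apply: is_manifold_vect; exact: norm_hausdorff. Qed.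

Lemma is_manifold_plane : is_manifold (@plane R).
Proof.
by apply: is_manifold_vect; exact: (@norm_hausdorff R (R^o * R^o)%type).
Qed.

Lemma smooth_vect (E F : tvsType R) (f : E -> F) :
  (forall k, Ck k [set: E] f) -> @smooth_map R (vect_space E) (vect_space F) f.
Proof.
move=> Cf; split=> [|_ _ -> -> k]; last exact: Ck_subset (Cf k).
by apply/continuous_subspace_setT; exact: Ck_continuous (Cf 0%N).
Qed.

Lemma tmap_comp M N P (g : N -> P) (f : M -> N) (p : M) (v : tangent p) :
  is_manifold M -> is_manifold N -> is_manifold P ->
  smooth_map g -> smooth_map f ->
  tmap (g \o f) v = tmap g (tmap f v).
Proof.
move=> [_ chM atM _] [[_ hN] chN atN _] [[_ hP] chP atP _] [cg sg] [cf sf].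
have [Mc cp] := atM p; have [Ne efp] := atN (f p).
have [Pd dgfp] := atP (g (f p)).
rewrite /tmap /=; set c := chart_at M p in Mc cp *.
set e := chart_at N (f p) in Ne efp *; set d := chart_at P _ in Pd dgfp *.
have oU := smooth_domain_open (chM _ Mc) (chN _ Ne) cf.
have oV := smooth_domain_open (chN _ Ne) (chP _ Pd) cg.
have [_ _ cK _ _] := chM _ Mc; have [_ _ eK _ _] := chN _ Ne.
have [_ [df [fdf _]]] := sf c e Mc Ne 1%N.
have [_ [dg [gdg [cdg _]]]] := sg e d Ne Pd 1%N.
have Ucp : (cmap c @` (cdom c `&` f @^-1` cdom e)) (cmap c p) by exists p.
have Vefp : (cmap e @` (cdom e `&` g @^-1` cdom d)) (cmap e (f p)).
  by exists (f p).
rewrite (dderivE hN (fdf _ v Ucp)) (dderivE hP (gdg _ _ Vefp)).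
(* The two coordinate expressions agree only where [f] lands in the domain of [e], which is a
   neighbourhood of the point and so determines the derivative. *)
rewrite (@dderiv_near _ _ _ _
  ((cmap d \o g \o cinv e) \o (cmap e \o f \o cinv c))); last first.
  apply: filterS (open_nbhs_nbhs (conj oU Ucp)) => _ [q [/= cq eq] <-].
  by rewrite cK//= eK.
apply: dderivE => //.
have := has_dderiv_comp oV _ gdg cdg (fdf _ v Ucp).
by rewrite /= cK//; apply.
Qed.

End Manifolds.

(** * Path homotopies *)

Section PathHomotopy.
Context {R : realType}.
Implicit Types S T U V : topologicalType.

Local Notation square := (`[(0 : R), 1]%classic `*` `[(0 : R), 1]%classic).

Lemma continuous_pair S U V (f : S -> U) (g : S -> V) :
  continuous f -> continuous g -> continuous (fun x => (f x, g x)).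
Proof. by move=> cf cg x; exact: cvg_pair (cf x) (cg x). Qed.

Lemma continuous_fst U V : continuous (@fst U V).
Proof. by move=> p; exact: cvg_fst. Qed.

Lemma continuous_snd U V : continuous (@snd U V).
Proof. by move=> p; exact: cvg_snd. Qed.

Lemma closed_setX U V (A : set U) (B : set V) :
  closed A -> closed B -> closed (A `*` B).
Proof.
move=> cA cB; have -> : A `*` B = fst @^-1` A `&` snd @^-1` B by [].
apply: closedI; apply: closed_comp => // p _; [exact: continuous_fst|].
exact: continuous_snd.
Qed.

Lemma path_homotopic_refl T (a : R -> T) : continuous a -> path_homotopic a a.
Proof.
move=> ca; exists (a \o fst); split=> //.
apply: continuous_subspaceT => p; apply: continuous_comp; last exact: ca.
exact: continuous_fst.
Qed.

Lemma path_homotopic_ends T (a b : R -> T) :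
  path_homotopic a b -> a 0 = b 0 /\ a 1 = b 1.
Proof.
have [i0 i1] : (0 : R) \in `[0, 1] /\ (1 : R) \in `[0, 1].
  by rewrite ?in_itv /= !lexx ler01.
move=> [F [_ Fh Fv]]; have [F0 F1] := Fv 1 i1.
by rewrite -F0 -F1 (Fh 0 i0).2 (Fh 1 i1).2.
Qed.

Lemma path_homotopic_sym T (a b : R -> T) :
  path_homotopic a b -> path_homotopic b a.
Proof.
move=> ab; have [ab0 ab1] := path_homotopic_ends ab.
have [F [cF Fh Fv]] := ab.
have itvB (s : R) : s \in `[0, 1] -> 1 - s \in `[0, 1].
  by rewrite ?in_itv /=; lra.
exists (fun p => F (p.1, 1 - p.2)); split=> [|t t01|s s01] /=.
- apply: (within_continuous_comp_sub (B := square)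
    (f := fun p : R * R => (p.1, 1 - p.2))) cF.
    by move=> _ [[t s] [/= t01 s01] <-]; split=> //=; exact: itvB.
  apply: continuous_subspaceT; apply: continuous_pair => [|p].
    exact: continuous_fst.
  by apply: cvgB; [exact: cvg_cst | exact: cvg_snd].
- by rewrite subr0 subrr; have [] := Fh t t01.
- by rewrite -ab0 -ab1; apply: Fv; exact: itvB.
Qed.

(** The two homotopies run one after the other at double speed in [s]; they are continuous on two
    closed strips and both equal [b] on the common edge. *)
Lemma path_homotopic_trans T (b a c : R -> T) :
  path_homotopic a b -> path_homotopic b c -> path_homotopic a c.
Proof.
move=> ab; have [ab0 ab1] := path_homotopic_ends ab.
have [F [cF Fh Fv]] := ab; move=> [G [cG Gh Gv]].
pose K p := if p.2 <= 2^-1 then F (p.1, 2 * p.2) else G (p.1, 2 * p.2 - 1).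
have half0 : (0 : R) <= 2^-1 by rewrite invr_ge0.
exists K; split=> [|t t01|s s01]; rewrite /K /=.
- have -> : square = `[(0 : R), 1]%classic `*` `[(0 : R), 2^-1]%classic `|`
      `[(0 : R), 1]%classic `*` `[(2^-1 : R), 1]%classic.
    apply/seteqP; split=> [[t s] [/= t01]|[t s] [] [/= t01]];
      rewrite /= !in_itv /=.
    + move=> s01; have [s2|s2] := leP s 2^-1; [left | right]; split=> //=;
        rewrite ?in_itv /=; lra.
    + by move=> s2; split=> //=; rewrite ?in_itv /=; lra.
    + by move=> s2; split=> //=; rewrite ?in_itv /=; lra.
  have closed_strip (u v : R) :
      closed (`[(0 : R), 1]%classic `*` `[u, v]%classic).
    by apply: closed_setX; exact: interval_closed.
  apply: withinU_continuous; try exact: closed_strip.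
    apply: (@subspace_eq_continuous _ _ _
      (F \o (fun p : R * R => (p.1, 2 * p.2)))).
      move=> [t s]; rewrite inE => -[/= _]; rewrite ?in_itv /= => /andP[_ s2].
      by rewrite /from_subspace /= s2.
    apply: (within_continuous_comp_sub (B := square)) cF.
      move=> _ [[t s] [/= t01 s01] <-]; split=> //=.
      by move: s01; rewrite ?in_itv /=; lra.
    apply: continuous_subspaceT; apply: continuous_pair => [|p].
      exact: continuous_fst.
    by apply: cvgM; [exact: cvg_cst | exact: cvg_snd].
  apply: (@subspace_eq_continuous _ _ _
    (G \o (fun p : R * R => (p.1, 2 * p.2 - 1)))).
    move=> [t s]; rewrite inE => -[/= t01]; rewrite ?in_itv /= => /andP[s2 _].
    rewrite /from_subspace /=; case: ifPn => // s2'.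
    have -> : s = 2^-1 by apply/eqP; rewrite eq_le s2 s2'.
    by rewrite divff// subrr (Fh t t01).2 (Gh t t01).1.
  apply: (within_continuous_comp_sub (B := square)) cG.
    move=> _ [[t s] [/= t01 s01] <-]; split=> //=.
    by move: s01; rewrite ?in_itv /=; lra.
  apply: continuous_subspaceT; apply: continuous_pair => [|p].
    exact: continuous_fst.
  apply: cvgB; last exact: cvg_cst.
  by apply: cvgM; [exact: cvg_cst | exact: cvg_snd].
- rewrite half0 mulr0 (Fh t t01).1; split=> //.
  have -> : (1 <= 2^-1 :> R) = false by apply/negP; lra.
  by rewrite mulr1 [2 - 1](_ : _ = 1) ?(Gh t t01).2//; lra.
- move: s01; rewrite ?in_itv /= => s01; case: ifPn => s2.
    by apply: Fv; rewrite ?in_itv /=; lra.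
  rewrite ab0 ab1; apply: Gv.
  by rewrite in_itv /=; move: s2; rewrite -ltNge; lra.
Qed.

Lemma path_homotopic_map2 T U V (phi : U * V -> T) (a b : R -> U)
    (c d : R -> V) : continuous phi ->
  path_homotopic a b -> path_homotopic c d ->
  path_homotopic (fun t => phi (a t, c t)) (fun t => phi (b t, d t)).
Proof.
move=> cphi [F [cF Fh Fv]] [G [cG Gh Gv]].
exists (fun p => phi (F p, G p)); split=> [x|t t01|s s01].
- apply: (@cvg_comp _ _ _ (fun p : subspace square => (F p, G p)) phi);
    last exact: cphi.
  exact: cvg_pair (cF x) (cG x).
- by rewrite (Fh t t01).1 (Fh t t01).2 (Gh t t01).1 (Gh t t01).2.
- by rewrite (Fv s s01).1 (Fv s s01).2 (Gv s s01).1 (Gv s s01).2.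
Qed.

Lemma path_homotopic_map T U (phi : U -> T) (a b : R -> U) :
  continuous phi -> path_homotopic a b ->
  path_homotopic (phi \o a) (phi \o b).
Proof.
(* The binary statement is used with a map that ignores its second argument. *)
move=> cphi ab; apply: (path_homotopic_map2 (phi := phi \o fst)) (ab) (ab).
by move=> p; apply: continuous_comp; [exact: cvg_fst | exact: cphi].
Qed.

Lemma eq_path_class (G : lieGroup R) (a b : R -> G) :
  path_homotopic a b -> path_class a = path_class b.
Proof.
move=> ab; apply/seteqP; split=> f [sf hf]; split=> //.
  exact: path_homotopic_trans (path_homotopic_sym ab) hf.
exact: path_homotopic_trans ab hf.
Qed.

End PathHomotopy.

(** * Conjugation of paths and of homotopy classes *)

Section NormalConjugation.
Context {R : realType} (G H : lieGroup R) (N : normalSubgroup G H).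
Implicit Types (h k : H) (a b : G) (f g : R -> G) (A B : set (R -> G)).

(** This identity and the next two are checked in [H], where [nconj] becomes genuine conjugation,
    and pulled back along the injective [nincl]. *)
Lemma nconj1h a : nconj N 1%g a = a.
Proof. by apply: (@nincl_inj _ _ _ N); rewrite nconjE mul1g invg1 mulg1. Qed.

Lemma nconjMh h k a : nconj N (h * k)%g a = nconj N h (nconj N k a).
Proof.
by apply: (@nincl_inj _ _ _ N); rewrite !nconjE invgM !mulgA.
Qed.

Lemma nconjM h a b : nconj N h (a * b)%g = (nconj N h a * nconj N h b)%g.
Proof.
apply: (@nincl_inj _ _ _ N).
by rewrite nincl_mul !nconjE nincl_mul !mulgA mulgVK.
Qed.

Lemma nconj1 h : nconj N h 1%g = 1%g.
Proof. by apply: (mulgI (nconj N h 1%g)); rewrite -nconjM !mulg1. Qed.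

Lemma nconjV h a : nconj N h (a^-1)%g = ((nconj N h a)^-1)%g.
Proof. by apply: (mulgI (nconj N h a)); rewrite -nconjM !mulgV nconj1. Qed.

Lemma nconjK h : cancel (nconj N h) (nconj N h^-1%g).
Proof. by move=> a; rewrite -nconjMh mulVg nconj1h. Qed.

Lemma nconjVK h : cancel (nconj N h^-1%g) (nconj N h).
Proof. by move=> a; rewrite -nconjMh mulgV nconj1h. Qed.

Lemma smooth_nconj h : @smooth_map R (lie_space G) (lie_space G) (nconj N h).
Proof.
apply: (@smooth_map_slicer R (lie_space H) (lie_space G) (lie_space G)
  (fun p => nconj N p.1 p.2)); try exact: lie_manifold.
exact: nconj_smooth.
Qed.

Lemma continuous_nconj h : continuous (nconj N h).
Proof. exact: (smooth_nconj h).1. Qed.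

Lemma smooth_path_nconj h g : @smooth_path R (lie_space G) g ->
  @smooth_path R (lie_space G) (fun t => nconj N h (g t)).
Proof.
apply: smooth_map_comp (smooth_nconj h); try exact: lie_manifold.
exact: is_manifold_line.
Qed.

Lemma smooth_path_continuous g : @smooth_path R (lie_space G) g ->
  continuous (g : R -> G).
Proof. by move=> [cg _]. Qed.

(* Replaces membership in [tilde G], so that products of smooth paths need not
   be shown to be smooth. *)
Definition saturated A : Prop := forall f, A f ->
  @smooth_path R (lie_space G) f /\ path_class f `<=` A.

Lemma saturated_path_class f : saturated (path_class f).
Proof.
move=> g [sg fg]; split=> // k [sk gk]; split=> //.
exact: path_homotopic_trans fg gk.
Qed.

Lemma saturated_tilde A : tilde G A -> saturated A.
Proof. by move=> [f [_ _ ->]]; exact: saturated_path_class. Qed.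

Lemma saturated_texp A (k : nat) : saturated (texp A k).
Proof.
case: k => [|k]; first exact: saturated_path_class.
move=> f [a Aa [b Bb] abf]; have [sf sub] := saturated_path_class abf.
by split=> // g /sub abg; exists a => //; exists b.
Qed.

Lemma hconj_mem h A g : @smooth_path R (lie_space G) g -> A g ->
  hconj N h A (fun t => nconj N h (g t)).
Proof.
move=> sg Ag; exists g => //; split; first exact: smooth_path_nconj.
apply: path_homotopic_refl; apply: smooth_path_continuous.
exact: smooth_path_nconj.
Qed.

(** [hconj] closes its result under homotopy, so the round trip gives back [A] because [A] is
    already closed under homotopy and consists of smooth paths. *)
Lemma hconjK h A : saturated A -> hconj N h^-1%g (hconj N h A) = A.
Proof.
move=> satA; apply/seteqP; split=> [q [p [g Ag [sp gp]] [sq pq]]|g Ag].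
  have [_] := satA g Ag; apply; split=> //.
  apply: path_homotopic_trans pq.
  have := path_homotopic_map (@continuous_nconj h^-1%g) gp.
  by congr path_homotopic; apply/funext => t /=; rewrite nconjK.
have [sg _] := satA g Ag.
have := hconj_mem h^-1%g (smooth_path_nconj h sg) (hconj_mem h sg Ag).
by congr (hconj _ _ _ _); apply/funext => t; rewrite nconjK.
Qed.

Lemma hconj_tone h : hconj N h (tone G) = tone G.
Proof.
apply/seteqP; split=> [q [p [sp op] [sq pq]]|q [sq oq]].
  split=> //; apply: path_homotopic_trans pq.
  have := path_homotopic_map (@continuous_nconj h) op.
  by congr path_homotopic; apply/funext => t /=; rewrite nconj1.
have sp := smooth_path_nconj h^-1%g sq.
have /(hconj_mem h sp) : tone G (fun t => nconj N h^-1%g (q t)).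
  split=> //; have := path_homotopic_map (@continuous_nconj h^-1%g) oq.
  by congr path_homotopic; apply/funext => t /=; rewrite nconj1.
by congr (hconj _ _ _ _); apply/funext => t; rewrite nconjVK.
Qed.

Lemma path_homotopic_mulg f f' g g' :
  path_homotopic f f' -> path_homotopic g g' ->
  path_homotopic (fun t => (f t * g t)%g) (fun t => (f' t * g' t)%g).
Proof.
apply: (path_homotopic_map2 (phi := fun p : G * G => (p.1 * p.2)%g)).
exact: (lie_mul_smooth G).1.
Qed.

Lemma hconj_tmul h A B : saturated A -> saturated B ->
  tmul (hconj N h A) (hconj N h B) = hconj N h (tmul A B).
Proof.
move=> satA satB; apply/seteqP; split=> q.
  move=> [f [a Aa [_ af]] [g [b Bb [_ bg]] [sq fgq]]].
  (* The smooth path [q], conjugated back by [h^-1], represents the class of the product of [a] and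
     [b]. *)
  have sp := smooth_path_nconj h^-1%g sq.
  have : tmul A B (fun t => nconj N h^-1%g (q t)).
    exists a => //; exists b => //; split=> //.
    have abq := path_homotopic_trans (path_homotopic_mulg af bg) fgq.
    have := path_homotopic_map (@continuous_nconj h^-1%g) abq.
    by congr path_homotopic; apply/funext => t /=; rewrite -nconjM nconjK.
  move=> /(hconj_mem h sp).
  by congr (hconj _ _ _ _); apply/funext => t; rewrite nconjVK.
move=> [p [a Aa [b Bb [_ abp]]] [sq pq]].
exists (fun t => nconj N h (a t)); first exact: hconj_mem (satA a Aa).1 Aa.
exists (fun t => nconj N h (b t)); first exact: hconj_mem (satB b Bb).1 Bb.
split=> //; apply: path_homotopic_trans pq.
have := path_homotopic_map (@continuous_nconj h) abp.
by congr path_homotopic; apply/funext => t /=; rewrite nconjM.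
Qed.

Lemma hconj_texp h A (k : nat) : saturated A ->
  texp (hconj N h A) k = hconj N h (texp A k).
Proof.
move=> satA; elim: k => [|k IHk]; first by rewrite hconj_tone.
rewrite [LHS](_ : _ = tmul (hconj N h A) (texp (hconj N h A) k))// IHk.
by rewrite hconj_tmul//; exact: saturated_texp.
Qed.

(* Conjugating by the reparametrized path [h_(t + s (1 - t))] interpolates
   between [h_t g_t h_t^-1] and [h_1 g_t h_1^-1]; the ends stay fixed because
   [g_0 = 1]. *)
Lemma tconj_hconj (B : set (R -> H)) A : tilde H B -> tilde G A ->
  exists h, tconj N B A = hconj N h A.
Proof.
move=> [h0 [sh0 _ BE]] [g0 [_ g01 AE]].
(* Homotopies fix endpoints, so all paths in [B] end at [h0 1]. *)
exists (h0 1).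
have Bh0 : B h0.
  by rewrite BE; split=> //; apply: path_homotopic_refl; exact: sh0.1.
have hom (h : R -> H) (g : R -> G) : B h -> A g ->
    path_homotopic (fun t => nconj N (h t) (g t))
                   (fun t => nconj N (h0 1) (g t)).
  rewrite BE AE => -[sh hh] [sg gg].
  have [_ h1] := path_homotopic_ends hh; have [g00 _] := path_homotopic_ends gg.
  have {}g00 : g 0 = 1%g by rewrite -g00.
  exists (fun p => nconj N (h (p.1 + p.2 * (1 - p.1))) (g p.1)).
  split=> [|t t01|s s01] /=.
  - apply: continuous_subspaceT => p.
    apply: (@continuous_comp _ _ _
      (fun p : R * R => (h (p.1 + p.2 * (1 - p.1)), g p.1))
      (fun p : H * G => nconj N p.1 p.2)); last exact: (nconj_smooth N).1.
    apply: continuous_pair.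
      move=> {}p; apply: (@continuous_comp _ _ _
        (fun p : R * R => p.1 + p.2 * (1 - p.1)) h); last exact: sh.1.
      apply: cvgD; first exact: cvg_fst.
      apply: cvgM; first exact: cvg_snd.
      by apply: cvgB; [exact: cvg_cst | exact: cvg_fst].
    move=> {}p; apply: continuous_comp; last exact: sg.1.
    exact: cvg_fst.
  - by rewrite mul0r addr0 mul1r subrKC h1.
  - by rewrite g00 !nconj1 subrr mulr0 addr0.
apply/seteqP; split=> q.
  move=> [h Bh [g Ag]]; rewrite (eq_path_class (hom h g Bh Ag)) => qc.
  by exists g.
move=> [g Ag]; rewrite -(eq_path_class (hom h0 g Bh0 Ag)) => qc.
by exists h0 => //; exists g.
Qed.

(** Conjugation is an automorphism, so it intertwines right translation by the inverse of [g t] with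
    right translation by the inverse of its conjugate. The chain rule applied to both sides at [g t]
    gives the claim. *)
Lemma right_velocity_nconj h g t : @smooth_path R (lie_space G) g ->
  right_velocity (fun t' => nconj N h (g t')) t =
  normal_Ad N h (right_velocity g t).
Proof.
move=> sg.
have sR a : @smooth_map R (lie_space G) (lie_space G) (fun b => (b * a)%g).
  apply: (@smooth_map_slicel R (lie_space G) (lie_space G) (lie_space G)
    (fun p => (p.1 * p.2)%g)); try exact: lie_manifold.
  exact: lie_mul_smooth.
have mG := lie_manifold G; have ml := @is_manifold_line R.
rewrite /right_velocity /velocity.
have := @tmap_comp R line (lie_space G) (lie_space G) (nconj N h) g t 1
  ml mG mG (smooth_nconj h) sg.
rewrite [X in @tmap R line _ X](_ : _ = (fun t' => nconj N h (g t')))// => ->.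
have := @tmap_comp R (lie_space G) (lie_space G) (lie_space G)
  (fun b => (b * (nconj N h (g t))^-1)%g) (nconj N h) (g t)
  (@tmap R line (lie_space G) g t 1) mG mG mG (sR _) (smooth_nconj h).
move=> <-.
have -> : (fun b => (b * (nconj N h (g t))^-1)%g) \o nconj N h =
    nconj N h \o (fun b => (b * (g t)^-1)%g).
  by apply/funext => b /=; rewrite nconjM nconjV.
have := @tmap_comp R (lie_space G) (lie_space G) (lie_space G)
  (nconj N h) (fun b => (b * (g t)^-1)%g) (g t)
  (@tmap R line (lie_space G) g t 1) mG mG mG (smooth_nconj h) (sR _).
(* The translated vector is based at [g t * (g t)^-1], which is [1], so the derivative of
   conjugation there is [normal_Ad]. *)
by move=> ->; rewrite /normal_Ad mulgV.
Qed.

End NormalConjugation.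

(** * Invariance of the quasimorphisms *)

Section Transport.
Context {R : realType} (X : domicToledo R).
Implicit Types H : lieGroup R.

Lemma smooth_act H (actH : H -> X -> X) h : lie_action actH ->
  @smooth_map R X X (actH h).
Proof.
move=> [_ _ sact].
apply: (@smooth_map_slicer R (lie_space H) X X (fun p => actH p.1 p.2)) => //.
- exact: lie_manifold.
- exact: dt_manifold.
- exact: dt_manifold.
Qed.

Lemma smooth_path_slices (sigma : R * R -> X) (t s : R) :
  @smooth_map R plane X sigma ->
  @smooth_path R X (fun t' => sigma (t', s)) /\
  @smooth_path R X (fun s' => sigma (t, s')).
Proof.
move=> ss; have mX := dt_manifold X.
have [ml mp] := (@is_manifold_line R, @is_manifold_plane R).
split.
  apply: (smooth_map_comp ml mp mX ss).
  apply: smooth_vect => k; apply: Ck_pair; last exact: Ck_cst.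
  by apply: Ck_linear => // x; exact: cvg_id.
apply: (smooth_map_comp ml mp mX ss).
apply: smooth_vect => k; apply: Ck_pair; first exact: Ck_cst.
by apply: Ck_linear => // x; exact: cvg_id.
Qed.

Lemma velocity_comp (f : X -> X) (c : R -> X) (t : R) :
  @smooth_map R X X f -> smooth_path c ->
  velocity (fun t' => f (c t')) t = tmap f (velocity c t).
Proof.
move=> sf sc.
have mX := dt_manifold X.
exact: (tmap_comp (M := line) 1 (@is_manifold_line R) mX mX).
Qed.

Lemma disk_integral_act H (actH : H -> X -> X) h (sigma : R * R -> X) :
  lie_action actH -> preserves_form actH (dt_form X) ->
  @smooth_map R plane X sigma ->
  disk_integral (dt_form X) (actH h \o sigma) = disk_integral (dt_form X) sigma.
Proof.
move=> lact pform ss; rewrite /disk_integral.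
apply: eq_Rintegral => s _; apply: eq_Rintegral => t _.
have [sc sd] := smooth_path_slices t s ss.
rewrite (velocity_comp t (smooth_act h lact) sc).
rewrite (velocity_comp s (smooth_act h lact) sd).
exact: pform.
Qed.

Lemma fills_act H (actH : H -> X -> X) h (sigma : R * R -> X)
    (a b c a' b' c' : R -> X) : lie_action actH ->
  (forall t, t \in `[0, 1] ->
    [/\ actH h (a t) = a' t, actH h (b t) = b' t & actH h (c t) = c' t]) ->
  fills sigma a b c -> fills (actH h \o sigma) a' b' c'.
Proof.
move=> lact eqs [ss bd]; split.
  apply: smooth_map_comp (smooth_act h lact) ss; try exact: dt_manifold.
  exact: is_manifold_plane.
move=> t t01; have [s0 s1 s2 s3] := bd t t01.
(* The edge [c] is traversed backwards, hence the parameter [1 - t]; the collapsed edge sits at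
   [a 0], hence the parameter [0] below. *)
have t01' : 1 - t \in `[0, 1] by move: t01; rewrite !in_itv /=; lra.
have z01 : (0 : R) \in `[0, 1] by rewrite in_itv /= lexx ler01.
have [ea eb _] := eqs t t01; have [_ _ ec] := eqs _ t01'.
have [ez _ _] := eqs 0 z01.
by split=> /=; rewrite ?s0 ?s1 ?s2 ?s3.
Qed.

Variables (G H : lieGroup R) (actG : G -> X -> X).
Variables (mu : lie_algebra G -> X -> R).
Variables (N : normalSubgroup G H) (actH : H -> X -> X).
Hypothesis lact : lie_action actH.
Hypothesis pform : preserves_form actH (dt_form X).
Hypothesis ppath : preserves_paths actH (dt_path X).
Hypothesis act_extends : forall g x, actH (nincl N g) x = actG g x.
Hypothesis mu_equiv : forall h V x, mu (normal_Ad N h V) (actH h x) = mu V x.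

(** The candidates among which [nu_at] chooses by [get]; equality of these sets gives equality of
    the chosen values. *)
Let nu_values x (A : set (R -> G)) : set R :=
  [set r | exists (g : R -> G) (sigma : R * R -> X),
    [/\ A g,
        fills sigma (fun t => actG (g t) x) (fun=> actG (g 1) x)
          (dt_path X (actG (g 1) x) x) &
        r = disk_integral (dt_form X) sigma
            - \int[lebesgue_measure]_(t in `[0, 1])
                mu (right_velocity g t) (actG (g t) x)]].

Lemma act_nconj h g x : actG (nconj N h g) (actH h x) = actH h (actG g x).
Proof.
have [_ actM _] := lact.
by rewrite -!act_extends nconjE -!actM mulgVK.
Qed.

(** Only one inclusion is stated, since the reverse one is the same statement for [h^-1]. *)
Lemma nu_values_act h x A : saturated A ->
  nu_values x A `<=` nu_values (actH h x) (hconj N h A).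
Proof.
move=> satA r [g [sigma [Ag fsigma ->]]]; have [sg _] := satA g Ag.
exists (fun t => nconj N h (g t)), (actH h \o sigma); split.
- exact: hconj_mem.
(* The first two edges are carried over by [act_nconj], and the closing path of the system by the
   invariance of the system under [h]. *)
- by apply: fills_act fsigma => // t t01; rewrite !act_nconj ppath.
- have [ss _] := fsigma.
  rewrite disk_integral_act//; congr (_ - _).
  apply: eq_Rintegral => t _.
  by rewrite act_nconj right_velocity_nconj// mu_equiv.
Qed.

Lemma nu_at_hconj h x A : saturated A ->
  nu_at actG mu x (hconj N h A) = nu_at actG mu (actH h^-1%g x) A.
Proof.
move=> satA; have [act1 actM _] := lact.
have sat_hA : saturated (hconj N h A).
  move=> f [g Ag fc]; have [sf sub] := saturated_path_class fc.
  by split=> // f' /sub f'c; exists g.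
congr get; apply/seteqP; split.
  (* Transporting the conjugated class by [h^-1] returns to [A], by [hconjK]. *)
  by have := nu_values_act h^-1%g (x := x) sat_hA; rewrite hconjK.
by have := nu_values_act h (x := actH h^-1%g x) satA; rewrite -actM mulgV act1.
Qed.

(** The limit in [nu] is required at every base point, and [x |-> h^-1 x] is a bijection of the base
    points, so both sides impose the same conditions on [r]. *)
Lemma nu_hconj h A : saturated A -> nu actG mu (hconj N h A) = nu actG mu A.
Proof.
move=> satA; have [act1 actM _] := lact.
have nu_atE x : (fun k => k%:R^-1 * nu_at actG mu x (texp (hconj N h A) k)) =
    (fun k => k%:R^-1 * nu_at actG mu (actH h^-1%g x) (texp A k)).
  apply/funext => k; rewrite hconj_texp// nu_at_hconj//.
  exact: saturated_texp.
congr get; apply/seteqP; split=> r rlim x.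
  (* The base point [h x] is taken so that the shift by [h^-1] leads back to [x]. *)
  by have := rlim (actH h x); rewrite nu_atE -actM mulVg act1.
by rewrite nu_atE; exact: rlim.
Qed.

End Transport.

Theorem proposition1p1 (R : realType) (X : domicToledo R) (G H : lieGroup R)
    (actG : G -> X -> X) (mu : lie_algebra G -> X -> R)
    (N : normalSubgroup G H) (actH : H -> X -> X) :
  hamiltonian_hermitian actG mu ->
  lie_action actH ->
  preserves_form actH (dt_form X) ->
  preserves_paths actH (dt_path X) ->
  (forall (g : G) (x : X), actH (nincl N g) x = actG g x) ->
  (forall (h : H) (V : lie_algebra G) (x : X),
      mu (normal_Ad N h V) (actH h x) = mu V x) ->
  [/\ (forall (A : set (R -> G)) (h : H) (x : X), tilde G A ->
         nu_at actG mu x (hconj N h A) = nu_at actG mu (actH (h^-1)%g x) A),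
      (forall (A : set (R -> G)) (h : H), tilde G A ->
         nu actG mu (hconj N h A) = nu actG mu A) &
      (forall (A : set (R -> G)) (B : set (R -> H)), tilde G A -> tilde H B ->
         nu actG mu (tconj N B A) = nu actG mu A)].
Proof.
move=> _ lact pform ppath act_ext mu_eq.
split=> [A h x /saturated_tilde satA|A h /saturated_tilde satA|A B tA tB].
- exact: (nu_at_hconj lact pform ppath act_ext mu_eq).
- exact: (nu_hconj lact pform ppath act_ext mu_eq).
- have [h ->] := tconj_hconj N tB tA.
  by apply: (nu_hconj lact pform ppath act_ext mu_eq); exact: saturated_tilde.
Qed.
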